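(* Let $q=p^l$ be a prime power ($p$ prime) and $\mathbb{F}_q$ the finite field of order $q$. Let $\mathcal{D}$ be a $1$-$(v,k,r)$ design with blocks $B_1,\ldots,B_b$ such that $k\equiv 0\pmod p$ and $|B_i\cap B_j|\equiv 0\pmod p$ for all $i,j\in\{1,\ldots,b\}$, $i\neq j$. Let $G$ be an automorphism group of $\mathcal{D}$ which acts on $\mathcal{D}$ with $f_1$ fixed points and $n$ point orbits of length $p^\alpha$, $1\leq\alpha\leq l$, and with $f_2$ fixed blocks and $m$ block orbits of length $p^\alpha$ (and no other orbits). Let $OM1$ and $OM2$ be, respectively, the submatrix of the orbit matrix indexed by fixed blocks and fixed points, and the submatrix indexed by block orbits and point orbits of length $p^\alpha$. Then: 1. the linear code spanned by the rows of $OM1$ is a self-orthogonal $[f_1,\operatorname{rank}(OM1)]$ code over $\mathbb{F}_q$; 2. the linear code spanned by the rows of $OM2$ is a self-orthogonal $[n,\operatorname{rank}(OM2)]$ code over $\mathbb{F}_q$.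
   Context: A $1$-$(v,k,r)$ design is a finite incidence structure with $v$ points and $b$ blocks such that every block is incident with exactly $k$ points and every point is incident with exactly $r$ blocks. For blocks $B_i,B_j$, $|B_i\cap B_j|$ is the number of points incident with both. An automorphism group of $\mathcal{D}$ is a group of incidence-preserving bijections (points to points, blocks to blocks) of $\mathcal{D}$. The orbit matrix under $G$ has rows indexed by block orbits $\mathcal{B}_i$ and columns by point orbits $\mathcal{V}_j$, with entry $a_{i,j}$ equal to the number of points of $\mathcal{V}_j$ incident with a block of $\mathcal{B}_i$ (independent of the chosen block). Order the orbits so that fixed points (columns $1,\ldots,f_1$) and fixed blocks (rows $1,\ldots,f_2$) come first. Then $OM1=[a_{i,j}]_{1\le i\le f_2,\,1\le j\le f_1}$ and $OM2=[a_{f_2+i,f_1+j}]_{1\le i\le m,\,1\le j\le n}$. Entries and ranks are taken in the field under consideration. An $[N,K]$ code has length $N$ and dimension $K$. A code $C\subseteq\mathbb{F}^N$ is self-orthogonal if $C\subseteq C^\perp$, where $C^\perp$ is the dual under the standard (bilinear) inner product. *)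

(* Defs.v *)
From HB Require Import structures.
From mathcomp Require Import all_boot all_order all_algebra all_fingroup.

Set Implicit Arguments.
Unset Strict Implicit.
Unset Printing Implicit Defensive.

Import GRing.Theory.
Local Open Scope ring_scope.

Section Designs.

Variables P B : finType.
Implicit Types (inc : P -> B -> bool).

(* Blocks form a type of their own, so repeated blocks are allowed. *)
Definition block_points inc (b : B) : {set P} := [set x | inc x b].
Definition point_blocks inc (x : P) : {set B} := [set b | inc x b].

Definition is_1design inc (v k r : nat) : Prop :=
  [/\ #|P| = v,
      forall b, #|block_points inc b| = k
    & forall x, #|point_blocks inc x| = r].

(* An automorphism is a pair (bijection of points, bijection of blocks). *)
Definition autT : finGroupType := ({perm P} * {perm B})%type.

Definition automorphism_group inc (G : {group autT}) : Prop :=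
  forall g : autT, g \in G -> forall x b, inc (g.1 x) (g.2 b) = inc x b.

Definition point_act (x : P) (g : autT) : P := g.1 x.
Definition block_act (b : B) (g : autT) : B := g.2 b.

Fact point_act1 : point_act^~ 1%g =1 id.
Proof. by move=> x; rewrite /point_act /= perm1. Qed.
Fact point_actM x : act_morph point_act x.
Proof. by move=> g h; rewrite /point_act /= permM. Qed.
Fact block_act1 : block_act^~ 1%g =1 id.
Proof. by move=> b; rewrite /block_act /= perm1. Qed.
Fact block_actM b : act_morph block_act b.
Proof. by move=> g h; rewrite /block_act /= permM. Qed.

Canonical point_action := TotalAction point_act1 point_actM.
Canonical block_action := TotalAction block_act1 block_actM.

End Designs.

Section Orbits.

Variables (aT : finGroupType) (T : finType) (to : {action aT &-> T}).
Implicit Types G : {group aT}.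

Definition orbits G : {set {set T}} := [set orbit to G x | x : T].

Definition orbit_structure G (f n len : nat) : Prop :=
  [/\ #|'Fix_to(G)%g| = f,
      #|[set O in orbits G | #|O| == len]| = n
    & forall O, O \in orbits G -> #|O| = 1%N \/ #|O| = len].

(* A repetition-free list of all the orbits in which the first f entries are *)
(* exactly the orbits of length 1. *)
Definition fixed_first_ordering G (f n : nat) (O : 'I_(f + n) -> {set T}) :=
  [/\ injective O,
      [set O i | i : 'I_(f + n)] = orbits G
    & forall i, (#|O i| == 1%N) = (i < f)%N].

End Orbits.

Section OrbitMatrix.

Variables P B : finType.
Variable inc : P -> B -> bool.

(* The value 0 for an empty [Bs] is never used: orbits are nonempty. See     *)
(* [orbit_entryE] for the independence of the chosen block.                  *)
Definition orbit_entry (Bs : {set B}) (Vs : {set P}) : nat :=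
  if [pick b in Bs] is Some b then #|Vs :&: block_points inc b| else 0%N.

Lemma orbit_entryE (G : {group autT P B}) (x : P) (c b : B) :
    automorphism_group inc G -> b \in orbit (block_action P B) G c ->
  orbit_entry (orbit (block_action P B) G c) (orbit (point_action P B) G x)
    = #|orbit (point_action P B) G x :&: block_points inc b|.
Proof.
move=> autG cb; rewrite /orbit_entry; case: pickP => [d cd|/(_ b)]; last first.
  by rewrite cb.
have /orbitP[g gG <-] : d \in orbit (block_action P B) G b.
  by apply: orbit_trans cd _; rewrite orbit_sym.
rewrite -[RHS](card_imset _ (@perm_inj _ g.1)); apply: eq_card => y.
rewrite -[y](permKV g.1); set z := (g.1^-1)%g y.
rewrite (mem_imset _ _ (@perm_inj _ g.1)) !inE autG //; congr (_ && _).
exact: (orbit_actr (point_action P B) x z gG).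
Qed.

Definition orbit_matrix (s t : nat)
    (Bs : 'I_s -> {set B}) (Vs : 'I_t -> {set P}) : 'M[nat]_(s, t) :=
  \matrix_(i, j) orbit_entry (Bs i) (Vs j).

Variable F : nzSemiRingType.
Variables f1 n f2 m : nat.
Variables (Bs : 'I_(f2 + m) -> {set B}) (Vs : 'I_(f1 + n) -> {set P}).

Definition OM1 : 'M[F]_(f2, f1) :=
  map_mx (fun a : nat => a%:R) (ulsubmx (orbit_matrix Bs Vs)).
Definition OM2 : 'M[F]_(m, n) :=
  map_mx (fun a : nat => a%:R) (drsubmx (orbit_matrix Bs Vs)).

End OrbitMatrix.

Section Codes.

Variables (F : finFieldType) (N : nat).

Definition dotv (u w : 'rV[F]_N) : F := \sum_i u 0 i * w 0 i.

Definition dual_code (C : {vspace 'rV[F]_N}) : {set 'rV[F]_N} :=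
  [set u | [forall w in C, dotv u w == 0]].

Definition self_orthogonal (C : {vspace 'rV[F]_N}) : Prop :=
  {subset C <= dual_code C}.

Definition row_code (s : nat) (A : 'M[F]_(s, N)) : {vspace 'rV[F]_N} :=
  <<[seq row i A | i : 'I_s]>>%VS.

End Codes.

(* Main.v *)
Require Import Defs.
From mathcomp Require Import all_boot all_order all_algebra all_fingroup.
From mathcomp Require Import finfield.

Set Implicit Arguments.
Unset Strict Implicit.
Unset Printing Implicit Defensive.

Import GRing.Theory.
Local Open Scope ring_scope.

(** Why the theorem holds. Write a(i, t) for the number of points of the point
    orbit V_t on a block of the block orbit B_i, and d(t, j) for the number of
    blocks of B_j through a point of V_t; both are well defined because G acts
    by automorphisms, and d is the orbit matrix entry of the dual structure.
    Fix a block b of B_i and count the triples (b, x, b') with b' in B_j and x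
    a point on both b and b'. Counted by b' there are sum |b :&: b'| of them,
    a multiple of p because every summand is one, the summand for b' = b being
    k; counted by x there are sum_t a(i, t) * d(t, j). Hence that sum vanishes
    in the field ([sum_orbit_entry_dual_eq0]).

    Counting incidences between V_t and B_j gives
    |B_j| * a(j, t) = |V_t| * d(t, j) ([orbit_entry_dual_count]). So
    d(t, j) = a(j, t) when the two orbits have the same length. When B_j is
    fixed and V_t has length p^alpha, a(j, t) is a multiple of p^alpha, hence 0
    in the field; when V_t is fixed and B_j has length p^alpha, d(t, j) is.
    Therefore, for B_i and B_j both fixed, only the fixed V_t survive in the
    sum, which becomes the inner product of two rows of OM1; for B_i and B_j
    both of length p^alpha, only the V_t of length p^alpha survive and the sum
    is the inner product of two rows of OM2.

    Since every codeword is a combination u *m A of rows, A *m A^T = 0 makes the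
    whole row code self-orthogonal, and a row base of A is a basis of the code,
    whose dimension is thus the rank of A. *)

(** * Codes spanned by the rows of a matrix *)

Section RowCode.

Variables (F : finFieldType) (N : nat).

Lemma size_rows s (A : 'M[F]_(s, N)) : size [seq row i A | i : 'I_s] == s.
Proof. by rewrite size_map -cardT card_ord. Qed.

Lemma nth_rows s (A : 'M[F]_(s, N)) (i : 'I_s) :
  [seq row i A | i : 'I_s]`_i = row i A.
Proof. by rewrite (nth_map i) ?nth_ord_enum // size_enum_ord. Qed.

(** This turns questions about the abstract span [row_code A] into questions
    about the row space of A, to which matrix algebra applies. *)
Lemma mem_row_code s (A : 'M[F]_(s, N)) (u : 'rV_N) :
  (u \in row_code A) = (u <= A)%MS.
Proof.
apply/idP/idP => [Cu | /submxP[w ->]].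
  rewrite (@coord_span _ _ _ (Tuple (size_rows A)) u Cu).
  apply: summx_sub => i _; apply: scalemx_sub.
  by rewrite nth_rows row_sub.
rewrite mulmx_sum_row; apply: memv_suml => i _; apply: memvZ.
exact/memv_span/image_f.
Qed.

Lemma row_free_dim_row_code s (A : 'M[F]_(s, N)) :
  row_free A -> \dim (row_code A) = s.
Proof.
move=> freeA; rewrite -[RHS](eqP (size_rows A)); apply/eqP.
apply: (introT (@freeP _ _ _ (Tuple (size_rows A)))) => c c0 i.
have /(row_free_inj freeA) : (\row_j c j) *m A = 0 *m A.
  rewrite mul0mx mulmx_sum_row -[RHS]c0; apply: eq_bigr => j _.
  by rewrite mxE nth_rows.
by move/rowP/(_ i); rewrite !mxE.
Qed.

Lemma dim_row_code s (A : 'M[F]_(s, N)) : \dim (row_code A) = \rank A.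
Proof.
rewrite -(row_free_dim_row_code (row_base_free A)); congr (\dim _).
by apply/vspaceP => u; rewrite !mem_row_code eq_row_base.
Qed.

Lemma row_code_self_orthogonal s (A : 'M[F]_(s, N)) :
  A *m A^T = 0 -> self_orthogonal (row_code A).
Proof.
move=> AAt0 u; rewrite mem_row_code => /submxP[x ->].
rewrite inE; apply/forall_inP => w; rewrite mem_row_code => /submxP[y ->].
have -> : dotv (x *m A) (y *m A) = ((x *m A) *m (y *m A)^T) 0 0.
  rewrite [RHS]mxE; apply: eq_bigr => i _.
  by rewrite [(y *m A)^T i 0]mxE.
by rewrite trmx_mul mulmxA -(mulmxA x) AAt0 mulmx0 mul0mx mxE.
Qed.

End RowCode.

(** * Counting incidences along orbits *)

Section OrbitCounting.

Variables (P B : finType) (inc : P -> B -> bool) (G : {group autT P B}).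
Hypothesis autG : automorphism_group inc G.

Local Notation porbits := (orbits (point_action P B) G).
Local Notation borbits := (orbits (block_action P B) G).

(** The orbit matrix entry of the dual incidence structure. *)
Definition dual_orbit_entry (Vs : {set P}) (Bs : {set B}) : nat :=
  orbit_entry (fun b x => inc x b) Vs Bs.

Lemma orbit_entry_card V O b : V \in porbits -> O \in borbits -> b \in O ->
  orbit_entry inc O V = #|V :&: block_points inc b|.
Proof. by move=> /imsetP[x _ ->] /imsetP[c _ ->]; apply: orbit_entryE. Qed.

Lemma dual_orbit_entry_card V O x : V \in porbits -> O \in borbits -> x \in V ->
  dual_orbit_entry V O = #|O :&: point_blocks inc x|.
Proof.
move=> /imsetP[x0 _ ->] /imsetP[c _ ->] Vx.
rewrite /dual_orbit_entry /orbit_entry.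
case: pickP => [y Vy|/(_ x)]; last first.
  by rewrite Vx.
have /orbitP[g gG <-] : y \in orbit (point_action P B) G x.
  by apply: orbit_trans Vy _; rewrite orbit_sym.
(* g.2 carries the blocks of the orbit on x onto those on its image g.1 x. *)
rewrite -[RHS](card_imset _ (@perm_inj _ g.2)); apply: eq_card => d.
rewrite -[d](permKV g.2); set e := (g.2^-1)%g d.
rewrite (mem_imset _ _ (@perm_inj _ g.2)) !inE autG //; congr (_ && _).
exact: (orbit_actr (block_action P B) c e gG).
Qed.

(** Both sides count the incident pairs in V x O. *)
Lemma orbit_entry_dual_count V O : V \in porbits -> O \in borbits ->
  (#|O| * orbit_entry inc O V = #|V| * dual_orbit_entry V O)%N.
Proof.
move=> VG OG; rewrite -!sum_nat_const.
under eq_bigr => b Ob do rewrite (orbit_entry_card VG OG Ob) -sum1_card.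
under [RHS]eq_bigr => x Vx do
  rewrite (dual_orbit_entry_card VG OG Vx) -sum1_card.
rewrite (exchange_big_dep (mem V)) /= => [|b x _]; last by case/setIP.
apply: eq_bigr => x Vx; apply: eq_bigl => b.
by rewrite !inE Vx.
Qed.

(** The flags (x, b') with b' in O' and x on both b and b', counted by b' and,
    orbit by orbit, by x. *)
Lemma sum_card_meet_orbit O O' b : O \in borbits -> O' \in borbits -> b \in O ->
  (\sum_(b' in O') #|block_points inc b :&: block_points inc b'| =
   \sum_(V in porbits) orbit_entry inc O V * dual_orbit_entry V O')%N.
Proof.
move=> OG O'G Ob.
transitivity (\sum_(x in block_points inc b) #|O' :&: point_blocks inc x|)%N.
  under eq_bigr => b' _ do rewrite -sum1_card.
  under [RHS]eq_bigr => x _ do rewrite -sum1_card.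
  rewrite (exchange_big_dep (mem (block_points inc b))) /=; last first.
    by move=> b' x _ /setIP[].
  apply: eq_bigr => x bx; apply: eq_bigl => b'.
  by move: bx; rewrite !inE => ->.
rewrite (partition_big (orbit (point_action P B) G) (mem porbits)) /=;
  last by move=> x _; apply: imset_f.
apply: eq_bigr => V VG; rewrite (orbit_entry_card VG OG Ob) -sum_nat_const.
have orbit_eq x : (orbit (point_action P B) G x == V) = (x \in V).
  by case/imsetP: VG => y _ ->; rewrite orbit_eq_mem.
apply: eq_big => [x | x /andP[_]]; first by rewrite orbit_eq in_setI andbC.
by rewrite orbit_eq => Vx; rewrite (dual_orbit_entry_card VG O'G Vx).
Qed.

End OrbitCounting.

(** * Orbits listed with the fixed ones first *)

Lemma orbit_inhabited (aT : finGroupType) (T : finType) (to : {action aT &-> T})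
    (G : {group aT}) (O : {set T}) :
  O \in orbits to G -> exists x, x \in O.
Proof. by case/imsetP=> x _ ->; exists x; apply: orbit_refl. Qed.

Section OrderedOrbits.

Variables (aT : finGroupType) (T : finType) (to : {action aT &-> T}).
Variables (G : {group aT}) (f n len : nat) (O : 'I_(f + n) -> {set T}).
Hypothesis orderO : fixed_first_ordering to G O.

Lemma ordered_orbit_mem i : O i \in orbits to G.
Proof. by case: orderO => _ <- _; apply: imset_f. Qed.

Lemma ordered_orbit_fixed (i : 'I_f) : #|O (lshift n i)| = 1%N.
Proof. by case: orderO => _ _ Ofix; apply/eqP; rewrite Ofix /=. Qed.

Lemma ordered_orbit_moved (i : 'I_n) :
  orbit_structure to G f n len -> #|O (rshift f i)| = len.
Proof.
case: orderO => _ _ Ofix [_ _ /(_ _ (ordered_orbit_mem (rshift f i)))].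
by case=> // /eqP; rewrite Ofix /= ltnNge leq_addr.
Qed.

Lemma sum_ordered_orbits (R : nmodType) (w : {set T} -> R) :
  \sum_(V in orbits to G) w V = \sum_i w (O i).
Proof.
case: orderO => injO <- _; rewrite big_imset /=; last by move=> i j _ _ /injO.
by apply: eq_bigl => i; rewrite inE.
Qed.

End OrderedOrbits.

(** * The two parts of the orbit matrix *)

Section OrbitMatrixCodes.

Variables (F : finFieldType) (p len : nat).
Hypothesis pcharF : p \in [pchar F].
Hypothesis p_dvd_len : (p %| len)%N.

Variables (P B : finType) (inc : P -> B -> bool) (G : {group autT P B}).
Hypothesis autG : automorphism_group inc G.
Hypothesis p_dvd_meet :
  forall b b', (p %| #|block_points inc b :&: block_points inc b'|)%N.

Variables (f1 n f2 m : nat).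
Variables (Vs : 'I_(f1 + n) -> {set P}) (Bs : 'I_(f2 + m) -> {set B}).
Hypothesis Vs_structure : orbit_structure (point_action P B) G f1 n len.
Hypothesis Bs_structure : orbit_structure (block_action P B) G f2 m len.
Hypothesis Vs_ordering : fixed_first_ordering (point_action P B) G Vs.
Hypothesis Bs_ordering : fixed_first_ordering (block_action P B) G Bs.

Local Notation a i t := (orbit_entry inc (Bs i) (Vs t)).
Local Notation d t j := (dual_orbit_entry inc (Vs t) (Bs j)).

Lemma sum_orbit_entry_dual_eq0 i j : \sum_t (a i t)%:R * (d t j)%:R = 0 :> F.
Proof.
have BsG := ordered_orbit_mem Bs_ordering.
have [b Bi_b] := orbit_inhabited (BsG i).
rewrite -(sum_ordered_orbits Vs_ordering
  (fun V => (orbit_entry inc (Bs i) V)%:R *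
            (dual_orbit_entry inc V (Bs j))%:R)).
under eq_bigr do rewrite -natrM.
rewrite -natr_sum -(sum_card_meet_orbit autG (BsG i) (BsG j) Bi_b).
by apply/eqP; rewrite -(dvdn_pcharf pcharF) dvdn_sum.
Qed.

Lemma entry_dual_count t j : (#|Bs j| * a j t = #|Vs t| * d t j)%N.
Proof.
exact: (orbit_entry_dual_count autG (ordered_orbit_mem Vs_ordering t)
  (ordered_orbit_mem Bs_ordering j)).
Qed.

Let len_eq0 c : (len * c)%:R = 0 :> F.
Proof. by apply/eqP; rewrite -(dvdn_pcharf pcharF) dvdn_mulr. Qed.

(** A fixed block meets a moved point orbit in all or none of its points, so
    these entries of the orbit matrix vanish and only fixed points remain. *)
Lemma OM1_mul_tr_eq0 : OM1 inc F Bs Vs *m (OM1 inc F Bs Vs)^T = 0.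
Proof.
apply/matrixP => i j; rewrite !mxE -[RHS](sum_orbit_entry_dual_eq0
  (lshift m i) (lshift m j)) big_split_ord /= [X in _ = _ + X]big1 ?addr0.
  apply: eq_bigr => t _; rewrite !mxE; congr (_ * _%:R).
  have := entry_dual_count (lshift n t) (lshift m j).
  by rewrite (ordered_orbit_fixed Vs_ordering) (ordered_orbit_fixed Bs_ordering)
    !mul1n.
move=> t _; have := entry_dual_count (rshift f1 t) (lshift m i).
rewrite (ordered_orbit_moved Vs_ordering _ Vs_structure)
  (ordered_orbit_fixed Bs_ordering).
by rewrite mul1n => ->; rewrite len_eq0 mul0r.
Qed.

(** Dually, a fixed point lies on all or none of the blocks of a moved block
    orbit, so here the fixed points contribute nothing. *)
Lemma OM2_mul_tr_eq0 : (0 < len)%N ->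
  OM2 inc F Bs Vs *m (OM2 inc F Bs Vs)^T = 0.
Proof.
move=> len_gt0; apply/matrixP => i j; rewrite !mxE.
rewrite -[RHS](sum_orbit_entry_dual_eq0 (rshift f2 i) (rshift f2 j)).
rewrite big_split_ord /= [X in _ = X + _]big1 ?add0r.
  apply: eq_bigr => t _; rewrite !mxE; congr (_ * _%:R).
  have /eqP := entry_dual_count (rshift f1 t) (rshift f2 j).
  rewrite (ordered_orbit_moved Vs_ordering _ Vs_structure)
    (ordered_orbit_moved Bs_ordering _ Bs_structure).
  by rewrite eqn_pmul2l // => /eqP.
move=> t _; have := entry_dual_count (lshift n t) (rshift f2 j).
rewrite (ordered_orbit_fixed Vs_ordering)
  (ordered_orbit_moved Bs_ordering _ Bs_structure).
by rewrite mul1n => <-; rewrite len_eq0 mulr0.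
Qed.

End OrbitMatrixCodes.

Theorem theorem9
    (p l alpha : nat) (F : finFieldType)
    (P B : finType) (inc : P -> B -> bool) (v k r : nat)
    (G : {group autT P B}) (f1 n f2 m : nat)
    (Vs : 'I_(f1 + n) -> {set P}) (Bs : 'I_(f2 + m) -> {set B})
    (p_prime : prime p) (card_F : #|F| = (p ^ l)%N)
    (design : is_1design inc v k r)
    (p_dvd_k : (k = 0 %[mod p])%N)
    (p_dvd_meet : forall b1 b2 : B, b1 != b2 ->
       (#|block_points inc b1 :&: block_points inc b2| = 0 %[mod p])%N)
    (autG : automorphism_group inc G)
    (alpha_bounds : (1 <= alpha <= l)%N)
    (point_orbits : orbit_structure (point_action P B) G f1 n (p ^ alpha))
    (block_orbits : orbit_structure (block_action P B) G f2 m (p ^ alpha))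
    (Vs_ordering : fixed_first_ordering (point_action P B) G Vs)
    (Bs_ordering : fixed_first_ordering (block_action P B) G Bs) :
  (self_orthogonal (row_code (OM1 inc F Bs Vs)) /\
     \dim (row_code (OM1 inc F Bs Vs)) = \rank (OM1 inc F Bs Vs)) /\
  (self_orthogonal (row_code (OM2 inc F Bs Vs)) /\
     \dim (row_code (OM2 inc F Bs Vs)) = \rank (OM2 inc F Bs Vs)).
Proof.
have pcharF := card_finPcharP card_F p_prime.
have p_dvd_len : (p %| p ^ alpha)%N.
  by case/andP: alpha_bounds => alpha_gt0 _; rewrite dvdn_exp.
have p_dvd_meet_all b b' :
    (p %| #|block_points inc b :&: block_points inc b'|)%N.
  have [<- | neq_bb'] := eqVneq b b'; last by rewrite /dvdn p_dvd_meet ?mod0n.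
  by case: design => _ card_b _; rewrite setIid card_b /dvdn p_dvd_k mod0n.
split; split; rewrite ?dim_row_code //; apply: row_code_self_orthogonal.
  exact: (OM1_mul_tr_eq0 pcharF p_dvd_len autG).
by apply: (OM2_mul_tr_eq0 pcharF p_dvd_len autG) => //;
  rewrite expn_gt0 prime_gt0.
Qed.
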